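(* For any $m\ge2$, the Abel series $c_{A,m}$ and the Ferfera series $c_F=\sum_{k\ge0}k!\,x_1^k$ over the alphabet $X=\{x_1,\ldots,x_m\}$ satisfy $$c_{A,m}=c_F\,\tilde\circ\,(I-c_FN)^{-1}_\delta .$$
   Context: $X^*$ is the set of words over $X=\{x_1,\ldots,x_m\}$, with empty word $\mathrm{e}$, and $\mathbb{R}\langle\langle X\rangle\rangle$ is the set of real formal power series $c=\sum_{\eta\in X^*}\langle c,\eta\rangle\eta$ in the noncommuting letters; $\mathbf 1=1\mathrm{e}$. The shuffle product $\sqcup\!\sqcup$ is the bilinear (continuous) product determined by $(x_i\eta)\sqcup\!\sqcup(x_j\xi)=x_i(\eta\sqcup\!\sqcup(x_j\xi))+x_j((x_i\eta)\sqcup\!\sqcup\xi)$ and $\eta\sqcup\!\sqcup\mathrm{e}=\mathrm{e}\sqcup\!\sqcup\eta=\eta$. Abel series: $c_{A,m}$ is the generating series of the solution of $\dot z=\sum_{i=1}^m v_iz^{i+1}$, $z(0)=1$, i.e. $z(t)=\sum_{\eta}\langle c_{A,m},\eta\rangle E_\eta[v](t)$ with $E_{\mathrm{e}}[v]=1$ and $E_{x_i\eta}[v](t)=\int_0^tv_i(\tau)E_\eta[v](\tau)\,d\tau$. Explicitly, $c_{A,m}=\sum_{n\ge1}c_{A,m}(n)$, where $c_{A,m}(n)=0$ for $n<1$, $c_{A,m}(1)=\mathbf 1$, and $c_{A,m}(n)=\sum_{i=1}^m(n-i)\,c_{A,m}(n-i)\,x_i$ for $n\ge2$ (concatenation with $x_i$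 on the right). Toeplitz matrices: $N\in\mathbb{R}^{m\times m}$ is the nilpotent matrix with ones on the superdiagonal and zeros elsewhere, and $I$ is the identity matrix. For $d=(d_1,\ldots,d_{m-1})\in\mathbb{R}^{m-1}\langle\langle X\rangle\rangle$ put $d_{\mathrm{Toep}}=I+\sum_{i=1}^{m-1}d_iN^i$. The symbol $d_\delta$, also written $(d_{\mathrm{Toep}})_\delta$, denotes $d$ viewed as an element of the group described below. Thus $(I-c_FN)_\delta$ corresponds to $d=(-c_F,0,\ldots,0)$. Mixed composition product: for $d\in\mathbb{R}^{m-1}\langle\langle X\rangle\rangle$ and $c\in\mathbb{R}\langle\langle X\rangle\rangle$, $$c\,\tilde\circ\,d_\delta=\sum_{\eta\in X^*}\langle c,\eta\rangle\,\phi_d(\eta)(\mathbf 1),$$ where $\phi_d(\mathrm{e})$ is the identity map on $\mathbb{R}\langle\langle X\rangle\rangle$, $\phi_d(x_i\eta)=\phi_d(x_i)\circ\phi_d(\eta)$, and $\phi_d(x_i)(e)=x_ie+\sum_{j=1}^{m-i}x_{i+j}(d_j\sqcup\!\sqcup e)$ for $e\in\mathbb{R}\langle\langle X\rangle\rangle$, $1\le i\le m$. On matrices of series, $\tilde\circ\,d_\delta$ acts entrywise. Group: $\mathbb{R}^{m-1}\langle\langle X\rangle\rangle$ is a group under the product $c_\delta\circ d_\delta$ determined by $(c_\delta\circ d_\delta)_{\mathrm{Toep}}=(c_{\mathrm{Toep}}\,\tilde\circ\,d_\delta)\sqcup\!\sqcup d_{\mathrm{Toep}}$, where the right-hand side is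 the matrix product in which entries are multiplied by the shuffle product; the identity element is $0_\delta$ (with $0_{\mathrm{Toep}}=I$). $d_\delta^{-1}$ denotes the inverse in this group, and $(I-c_FN)^{-1}_\delta$ is the group inverse of $(I-c_FN)_\delta$. *)

(* Defs.v *)
From mathcomp Require Import all_boot all_order all_algebra.
From mathcomp Require Import boolp classical_sets functions cardinality fsbigop reals.

Set Implicit Arguments.
Unset Strict Implicit.
Unset Printing Implicit Defensive.

Import Order.TTheory GRing.Theory Num.Theory.
Local Open Scope classical_set_scope.
Local Open Scope ring_scope.

(* The alphabet X = {x_1, ..., x_m} is 'I_m, with i : 'I_m
   standing for x_(i+1); words are sequences over 'I_m and a series is its
   coefficient function. *)
Definition fps (R : realType) (m : nat) := seq 'I_m -> R.

(* An m.-1 tuple (d_1, ..., d_(m-1)) of series; the index j : 'I_m.-1 stands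
   for d_(j+1). *)
Definition fpst (R : realType) (m : nat) := 'I_m.-1 -> fps R m.

Definition fps0 (R : realType) (m : nat) : fps R m := fun=> 0.
Arguments fps0 R m _ : clear implicits.

Definition word (R : realType) (m : nat) (u : seq 'I_m) : fps R m :=
  fun w => (w == u)%:R.
Arguments word R {m} u _.

Definition fps1 (R : realType) (m : nat) : fps R m := word R [::].
Arguments fps1 R m _ : clear implicits.

(* Left concatenation of the letter x_(k+1), where the index k is a natural
   number; it is 0 if m <= k. *)
Definition lcat (R : realType) (m : nat) (k : nat) (c : fps R m) : fps R m :=
  fun w => if w is y :: w' then (if y == k :> nat then c w' else 0) else 0.

(* Right concatenation of the letter x. *)
Definition rcat (R : realType) (m : nat) (c : fps R m) (x : 'I_m) : fps R m :=
  fun w => if w is y :: w' then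
    (if last y w' == x then c (belast y w') else 0) else 0.

Fixpoint shuffle_word (R : realType) (m : nat) (u : seq 'I_m) :
    seq 'I_m -> fps R m :=
  match u with
  | [::] => fun v => word R v
  | x :: u' => fix shuffle_u (v : seq 'I_m) : fps R m :=
      match v with
      | [::] => word R (x :: u')
      | y :: v' => fun w => lcat x (shuffle_word R u' (y :: v')) w
                            + lcat y (shuffle_u v') w
      end
  end.
Arguments shuffle_word R {m} u _ _.

(* The bigop \sum_(x \in A) F x is 0 by convention when F has infinite support
   on A; this does not occur below: see shuffle_finite, mcomp_finite and
   abel_finite. *)
Definition shuffle (R : realType) (m : nat) (c d : fps R m) : fps R m :=
  fun w => \sum_(p \in [set: seq 'I_m * seq 'I_m])
             c p.1 * d p.2 * shuffle_word R p.1 p.2 w.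

(* phi_d(x_(i+1)); the letter x_((i+1)+(j+1)) has index i + j + 1. *)
Definition phi_letter (R : realType) (m : nat) (d : fpst R m) (i : 'I_m)
    (e : fps R m) : fps R m :=
  fun w => lcat i e w
    + \sum_(j < m.-1 | (i + j.+1 < m)%N) lcat (i + j.+1)%N (shuffle (d j) e) w.

Definition phi (R : realType) (m : nat) (d : fpst R m) (eta : seq 'I_m)
    (e : fps R m) : fps R m :=
  foldr (phi_letter d) e eta.

Definition mcomp (R : realType) (m : nat) (c : fps R m) (d : fpst R m) :
    fps R m :=
  fun w => \sum_(eta \in [set: seq 'I_m]) c eta * phi d eta (fps1 R m) w.

Definition nilpN (R : realType) (m : nat) : 'M[R]_m :=
  \matrix_(a, b) (b == a.+1 :> nat)%:R.

Definition toep (R : realType) (m : nat) (d : fpst R m) : 'M[fps R m]_m :=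
  \matrix_(a, b) fun w =>
    (1%:M : 'M[R]_m) a b * fps1 R m w
    + \sum_(i < m.-1) (nilpN R m ^+ i.+1) a b * d i w.

Definition mcomp_mx (R : realType) (m p q : nat) (A : 'M[fps R m]_(p, q))
    (d : fpst R m) : 'M[fps R m]_(p, q) :=
  map_mx (fun c => mcomp c d) A.

Definition shuffle_mx (R : realType) (m p q r : nat) (A : 'M[fps R m]_(p, q))
    (B : 'M[fps R m]_(q, r)) : 'M[fps R m]_(p, r) :=
  \matrix_(a, b) fun w => \sum_(k < q) shuffle (A a k) (B k b) w.

Lemma row0_subproof (m : nat) (i : 'I_m.-1) : (0 < m)%N.
Proof. by case: m i => [|m] [i]. Qed.

Lemma colS_subproof (m : nat) (i : 'I_m.-1) : (i.+1 < m)%N.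
Proof. by case: m i => [|m] i; [case: i | exact: ltn_ord]. Qed.

(* The group product. Its components are read off the first row of
   (c_Toep o~ d) sh d_Toep, which is a Toeplitz matrix: see toep_gmul. *)
Definition gmul (R : realType) (m : nat) (c d : fpst R m) : fpst R m :=
  fun i => shuffle_mx (mcomp_mx (toep c) d) (toep d)
             (Ordinal (row0_subproof i)) (Ordinal (colS_subproof i)).

Definition gone (R : realType) (m : nat) : fpst R m := fun=> fps0 R m.
Arguments gone R m _ _ : clear implicits.

(* The two-sided inverse, as a definite description; the default value d is
   irrelevant because every element is invertible. *)
Definition ginv (R : realType) (m : nat) (d : fpst R m) : fpst R m :=
  xget d [set e | gmul d e = gone R m /\ gmul e d = gone R m].

(* c_A(n); a term with n < i has the factor 0, consistently with c_A(k) = 0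
   for k < 1. *)
Fixpoint abel_hom (R : realType) (m : nat) (n : nat) : fps R m :=
  match n with
  | 0 => fps0 R m
  | 1 => fps1 R m
  | n'.+1 => fun w => \sum_(i < m)
      (n'.+1 - i.+1)%N%:R * rcat (@abel_hom R m (n'.+1 - i.+1)%N) i w
  end.
Arguments abel_hom R m n _ : clear implicits.

Definition abel (R : realType) (m : nat) : fps R m :=
  fun w => \sum_(n \in [set n | (1 <= n)%N]) abel_hom R m n w.
Arguments abel R m _ : clear implicits.

(* The coefficient of x_1^k is k!, all the others vanish. *)
Definition ferfera (R : realType) (m : nat) : fps R m :=
  fun w => if all (fun x : 'I_m => x == 0%N :> nat) w then (size w)`!%:R else 0.
Arguments ferfera R m _ : clear implicits.

(* (- c, 0, ..., 0), i.e. the element (I - c N)_delta: see toep_subN. *)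
Definition subN (R : realType) (m : nat) (c : fps R m) : fpst R m :=
  fun i => if i == 0%N :> nat then (fun w => - c w) else fps0 R m.

Section Facts.
Variables (R : realType) (m : nat).
Implicit Types (c d e : fps R m) (u v w : seq 'I_m).

Lemma shuffle_word_size u v w :
  size w != (size u + size v)%N -> shuffle_word R u v w = 0.
Proof.
elim: u v w => [|x u IHu] v w.
  by rewrite add0n /= /word; case: (w =P v) => // ->; rewrite eqxx.
elim: v w => [|y v IHv] w.
  by rewrite addn0 /= /word; case: (w =P _) => // ->; rewrite eqxx.
case: w => [|z w] sw /=; first by rewrite addr0.
move: sw; rewrite /= addSn eqSS => sw.
rewrite IHu // if_same add0r; case: ifP => // _.
by apply: IHv; rewrite /= addSn -addnS.
Qed.

Lemma finite_words (n : nat) : finite_set [set u : seq 'I_m | (size u <= n)%N].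
Proof.
elim: n => [|n IHn].
  apply: (@sub_finite_set _ _ [set [::]]); last exact: finite_set1.
  by case.
apply: (@sub_finite_set _ _ ([set [::]] `|`
  (fun p : 'I_m * seq 'I_m => p.1 :: p.2) @`
     ([set: 'I_m] `*` [set u | (size u <= n)%N]))).
  case=> [|x u] /= su; [by left | right].
  by exists (x, u).
rewrite finite_setU; split; first exact: finite_set1.
apply: finite_image; apply: finite_setX => //.
Qed.

Lemma shuffle_finite c d w : finite_set
  [set p : seq 'I_m * seq 'I_m | c p.1 * d p.2 * shuffle_word R p.1 p.2 w != 0].
Proof.
apply: (@sub_finite_set _ _ ([set u : seq 'I_m | (size u <= size w)%N] `*`
                             [set u : seq 'I_m | (size u <= size w)%N])).
  case=> u v /=; have [->|/shuffle_word_size->] := eqVneq (size w) (size u + size v)%N.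
    by rewrite leq_addr leq_addl.
  by rewrite mulr0 eqxx.
by apply: finite_setX; exact: finite_words.
Qed.

Lemma shuffle_low c d (n : nat) :
  (forall w, (size w < n)%N -> d w = 0) ->
  forall w, (size w < n)%N -> shuffle c d w = 0.
Proof.
move=> dn w wn; apply: fsbig1 => -[u v] _ /=.
have [sw|/shuffle_word_size->] := eqVneq (size w) (size u + size v)%N.
  by rewrite dn ?mulr0 ?mul0r // (leq_ltn_trans _ wn) // sw leq_addl.
by rewrite mulr0.
Qed.

Lemma phi_low (d : fpst R m) eta e w :
  (size w < size eta)%N -> phi d eta e w = 0.
Proof.
elim: eta w => [//|x eta IH] [|y w] /= sw; rewrite /phi_letter.
  by rewrite /= add0r big1.
rewrite /= -/(phi d eta e) IH // if_same add0r big1 // => j _.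
by rewrite (@shuffle_low _ _ (size eta)) ?if_same.
Qed.

Lemma mcomp_finite c (d : fpst R m) w :
  finite_set [set eta | c eta * phi d eta (fps1 R m) w != 0].
Proof.
apply: (sub_finite_set _ (finite_words (size w))) => eta /=.
by case: leqP => // /phi_low->; rewrite mulr0 eqxx.
Qed.

(* c_A(n) is homogeneous of degree n - 1 when x_i has degree i. *)
Lemma abel_hom_deg (n : nat) w :
  n != (sumn [seq i.+1 | i : 'I_m <- w]).+1 -> abel_hom R m n w = 0.
Proof.
elim/ltn_ind: n w => -[//|[|n] IH] w.
  by rewrite /= /fps1 /word; case: (w =P [::]) => // ->.
move=> nw; rewrite [LHS]/=; apply: big1 => i _.
case: w nw => [|y w] nw; first by rewrite /= mulr0.
rewrite /rcat; case: eqP => [lw|]; last by rewrite mulr0.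
have [ni|ni] := leqP n.+2 i.+1.
  by rewrite (_ : (n.+2 - i.+1)%N = 0%N) ?mul0r //; apply/eqP; rewrite subn_eq0.
rewrite IH ?mulr0 //; first by rewrite subSS ltnS leq_subr.
apply: contra nw; rewrite lastI map_rcons sumn_rcons lw => /eqP E.
by rewrite -addSn -E subnK // ltnW.
Qed.

Lemma abel_finite w : finite_set [set n | abel_hom R m n w != 0].
Proof.
apply: (@sub_finite_set _ _ [set (sumn [seq i.+1 | i : 'I_m <- w]).+1]);
  last exact: finite_set1.
move=> n /=.
by case: (eqVneq n (sumn [seq i.+1 | i : 'I_m <- w]).+1) => // /abel_hom_deg->;
  rewrite eqxx.
Qed.

Lemma shuffle0l d : shuffle (fps0 R m) d = fps0 R m.
Proof. by apply/funext=> w; apply: fsbig1 => p _; rewrite !mul0r. Qed.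

Lemma shuffle0r c : shuffle c (fps0 R m) = fps0 R m.
Proof. by apply/funext=> w; apply: fsbig1 => p _; rewrite mulr0 mul0r. Qed.

Lemma shuffle11 : shuffle (fps1 R m) (fps1 R m) = fps1 R m.
Proof.
apply/funext=> w; rewrite /shuffle.
rewrite -(fsbig_widen [set ([::], [::])]) // => [|[u v] [_ uv]].
  by rewrite fsbig_set1 /= /fps1 /word !eqxx !mul1r.
rewrite /preimage /= /fps1 /word; case: eqP uv => [->|]; last by rewrite !mul0r.
by case: eqP => [->|]; [case | rewrite mulr0 mul0r].
Qed.

Lemma mcomp0 (d : fpst R m) : mcomp (fps0 R m) d = fps0 R m.
Proof. by apply/funext=> w; apply: fsbig1 => p _; rewrite mul0r. Qed.

Lemma mcomp1 (d : fpst R m) : mcomp (fps1 R m) d = fps1 R m.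
Proof.
apply/funext=> w; rewrite /mcomp.
rewrite -(fsbig_widen [set [::]]) // => [|u [_ u0]].
  by rewrite fsbig_set1 /= {1}/fps1 /word eqxx mul1r.
by rewrite /preimage /= {1}/fps1 /word; case: eqP u0 => // _ _; rewrite mul0r.
Qed.

Lemma nilpN_exp (k : nat) (a b : 'I_m) :
  (nilpN R m ^+ k) a b = (b == (a + k)%N :> nat)%:R.
Proof.
elim: k a b => [|k IH] a b.
  by rewrite expr0 mxE addn0 -val_eqE /= eq_sym.
rewrite exprSr mxE.
under eq_bigr do rewrite IH mxE.
have [akm|mak] := ltnP (a + k)%N m.
  rewrite (bigD1 (Ordinal akm)) //= eqxx mul1r big1 ?addr0 ?addnS // => j.
  by rewrite -val_eqE /= => /negPf->; rewrite mul0r.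
rewrite big1 => [|j _].
  by rewrite ltn_eqF // addnS ltnS (leq_trans (ltnW (ltn_ord b))).
by rewrite ltn_eqF ?mul0r // (leq_trans (ltn_ord j)).
Qed.

(* The series in the k-th diagonal of a Toeplitz matrix. *)
Let diagc (d : fpst R m) (k : nat) : fps R m :=
  if k is k'.+1 then (if insub k' is Some i then d i else fps0 R m)
  else fps1 R m.

Lemma toepE (d : fpst R m) (a b : 'I_m) :
  toep d a b = if (a <= b)%N then diagc d (b - a)%N else fps0 R m.
Proof.
apply/funext=> w; rewrite !mxE -val_eqE /=.
under eq_bigr do rewrite nilpN_exp.
case: ltngtP => [ab|ab|ab].
- rewrite mul0r add0r -(subnSK ab) /=; case: insubP => [i _ iE|].
    rewrite (bigD1 i) //= iE subnSK // subnKC ?(ltnW ab) // eqxx mul1r.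
    rewrite big1 ?addr0 // => j; rewrite -val_eqE /= iE => ji.
    rewrite (_ : (_ == _) = false) ?mul0r //; apply: contra_neqF ji => /eqP->.
    by rewrite addnS subSS addKn.
  case/negP; have m0 : (0 < m)%N := leq_ltn_trans (leq0n _) (ltn_ord b).
  rewrite -ltnS prednK // subnSK //.
  by rewrite (leq_ltn_trans (leq_subr _ _)).
- rewrite mul0r add0r big1 // => j _.
  by rewrite ltn_eqF ?mul0r // ltn_addr.
- rewrite ab subnn /= mul1r big1 ?addr0 // => j _.
  by rewrite ltn_eqF ?mul0r // addnS ltnS leq_addr.
Qed.

Lemma toep_gmul (c d : fpst R m) :
  toep (gmul c d) = shuffle_mx (mcomp_mx (toep c) d) (toep d).
Proof.
apply/matrixP=> a b; rewrite toepE; apply/funext => w.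
pose F (k l : nat) := shuffle (mcomp (diagc c k) d) (diagc d l) w.
have entry (a' b' : 'I_m) :
    shuffle_mx (mcomp_mx (toep c) d) (toep d) a' b' w =
    \sum_(k < m | (a' <= k <= b')%N) F (k - a')%N (b' - k)%N.
  rewrite mxE [RHS]big_mkcond /=; apply: eq_bigr => k _.
  rewrite mxE !toepE; case: leqP => _ /=; last by rewrite mcomp0 shuffle0l.
  by case: leqP => _ //; rewrite shuffle0r.
have entry' (a' b' : 'I_m) : (a' <= b')%N ->
    shuffle_mx (mcomp_mx (toep c) d) (toep d) a' b' w =
    \sum_(0 <= k < (b' - a').+1) F k (b' - a' - k)%N.
  move=> ab; rewrite entry.
  transitivity (\sum_(a' <= k < m | (k <= b')%N) F (k - a')%N (b' - k)%N).
    by rewrite big_geq_mkord; apply: eq_bigl => k; rewrite andbC.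
  transitivity (\sum_(0 + a' <= k < b'.+1) F (k - a')%N (b' - k)%N).
    by rewrite add0n (big_nat_widen _ _ _ _ _ (ltn_ord b')).
  rewrite big_addn subSn //; apply: eq_bigr => k _.
  by rewrite addnK addnC subnDA.
have [ab|ab] := leqP a b; last first.
  rewrite entry big1 // => k /andP[ak kb].
  by have := leq_trans ak kb; rewrite leqNgt ab.
rewrite entry'//; case E : (b - a)%N => [|k].
  by rewrite big_nat1 /F /= mcomp1 shuffle11.
rewrite /=; case: insubP => [i _ iE|].
  by rewrite /gmul entry' //= subn0 iE.
case/negP; have m0 : (0 < m)%N := leq_ltn_trans (leq0n _) (ltn_ord b).
by rewrite -ltnS prednK // -E (leq_ltn_trans (leq_subr _ _)).
Qed.

Lemma toep_gone : toep (gone R m) =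
  \matrix_(a, b) (if a == b then fps1 R m else fps0 R m).
Proof.
apply/matrixP=> a b; apply/funext => w; rewrite !mxE.
rewrite big1 ?addr0 => [|i _]; last by rewrite mulr0.
by case: eqP => _; rewrite ?mul1r ?mul0r.
Qed.

Lemma toep_subN c : toep (subN c) =
  \matrix_(a, b) fun w => (1%:M : 'M[R]_m) a b * fps1 R m w
                          - nilpN R m a b * c w.
Proof.
apply/matrixP=> a b; apply/funext => w; rewrite !mxE; congr (_ + _).
have [m1|m1] := ltnP 0 m.-1.
  rewrite (bigD1 (Ordinal m1)) //= expr1 !mxE /subN /= mulrN big1 ?addr0 // => i.
  by rewrite -val_eqE /= => /negPf->; rewrite mulr0.
rewrite big1 => [|i _]; last by have := leq_trans (ltn_ord i) m1.
rewrite (_ : (_ == _) = false) ?mul0r ?oppr0 //; apply/negbTE/negP => /eqP ba.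
have : (a.+1 < m)%N by rewrite -ba.
by rewrite -ltn_predRL => /leq_trans/(_ m1).
Qed.
End Facts.

(* Main.v *)
(* Under the shuffle product the left derivatives D_a, which strip a leading
   letter x_a, are derivations, and a series is determined by its constant term
   and its left derivatives. The right-to-left recursion for c_A turns into
   D_a c_A = c_A^(a+1), because the coefficients of c_A^k obey the same recursion
   started at k; likewise D_1 c_F = c_F^2 and D_a c_F = 0 for a > 1.
   The map c |-> c o~ d is a shuffle homomorphism with
   D_a (c o~ d) = sum_(i <= a) d_(a-i) (D_i c o~ d), d_0 = 1.
   If e is a right inverse of I - c_F N and z = c_F o~ e, then
   (I - z N) e_Toep = I, i.e. e_j = z^j, hence D_a z = e_(a-1) z^2 = z^(a+1) and
   z = c_A. Conversely e_j = c_A^j is a two-sided inverse, because the systems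
   solved by c_F o~ e and c_A o~ (I - c_F N) are solved by c_A and c_F. *)
Require Import Defs.
From HB Require Import structures.
From mathcomp Require Import all_boot all_order all_algebra.
From mathcomp Require Import boolp classical_sets functions cardinality fsbigop reals.
From mathcomp Require Import zify.

Set Implicit Arguments.
Unset Strict Implicit.
Unset Printing Implicit Defensive.

Import GRing.Theory.
Local Open Scope classical_set_scope.
Local Open Scope ring_scope.

(** * Finite sums and words of bounded length *)

Lemma fsum_seqT (V : nmodType) (T : choiceType) (s : seq T) (F : T -> V) :
  uniq s -> (forall x, x \notin s -> F x = 0) ->
  \sum_(x \in [set: T]) F x = \sum_(x <- s) F x.
Proof.
move=> us F0; rewrite (@fsbigE _ _ _ _ _ s) //; last by move=> x _; exact: F0.
by apply: eq_bigl => x; rewrite in_setT.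
Qed.

Section Words.
Variable m : nat.

Fixpoint words (n : nat) : seq (seq 'I_m) :=
  if n is n'.+1 then [::] :: [seq i :: u | i <- enum 'I_m, u <- words n']
  else [:: [::]].

Lemma mem_words n u : (u \in words n) = (size u <= n)%N.
Proof.
elim: n u => [|n IHn] [|i u] //=.
rewrite inE ltnS -IHn /=; apply/allpairsP/idP => [[[j v] /= [_ vn [_ ->]]] //|un].
by exists (i, u); rewrite /= mem_enum.
Qed.

Lemma words_uniq n : uniq (words n).
Proof.
elim: n => //= n IHn; apply/andP; split; first by apply/allpairsP=> -[[j v] []].
by apply: allpairs_uniq => [|//|[i u] [j v] _ _ [-> ->]] //; exact: enum_uniq.
Qed.

Lemma big_wordsS (V : nmodType) n (F : seq 'I_m -> V) :
  \sum_(u <- words n.+1) F u =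
  F [::] + \sum_(i < m) \sum_(u <- words n) F (i :: u).
Proof. by rewrite big_cons big_allpairs_dep big_enum. Qed.
End Words.

(** * Shuffle product and left derivatives *)

Section LeftDerivative.
Variables (R : realType) (m : nat).
Implicit Types (c d e : fps R m) (u v w : seq 'I_m).

Definition lder (a : 'I_m) c : fps R m := fun w => c (a :: w).

Lemma shuffle_word_cons u v (a : 'I_m) w :
  shuffle_word R u v (a :: w) =
  (if u is x :: u' then if a == x then shuffle_word R u' v w else 0 else 0) +
  (if v is y :: v' then if a == y then shuffle_word R u v' w else 0 else 0).
Proof.
have nilv v' : shuffle_word R v' [::] = word R v' by case: v'.
case: u v => [|x u] [|y v] //=; rewrite ?nilv ?addr0 ?add0r /word ?eqseq_cons //.
- by case: eqP.
- by case: eqP.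
Qed.

(** The bounds [n] and [p] are independent because a left derivative shortens the words of one
    factor only. *)
Lemma shuffle_words c d w (n p : nat) : (size w <= n)%N -> (size w <= p)%N ->
  shuffle c d w = \sum_(u <- words m n) \sum_(v <- words m p)
                     c u * d v * shuffle_word R u v w.
Proof.
move=> wn wp.
rewrite /shuffle (@fsum_seqT _ _ [seq (u, v) | u <- words m n, v <- words m p]).
- by rewrite big_allpairs_dep.
- by apply: allpairs_uniq; rewrite ?words_uniq // => -[u v] [u' v'].
case=> u v /= /allpairsP uv; rewrite shuffle_word_size ?mulr0 //.
apply/negP=> /eqP sw; case: uv; exists (u, v); split=> //=; rewrite mem_words.
- by rewrite (leq_trans _ wn) // sw leq_addr.
- by rewrite (leq_trans _ wp) // sw leq_addl.
Qed.

Lemma sum_words_head n (a : 'I_m) c (F : seq 'I_m -> R) :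
  \sum_(u <- words m n.+1)
     c u * (if u is x :: u' then if a == x then F u' else 0 else 0) =
  \sum_(u <- words m n) c (a :: u) * F u.
Proof.
rewrite big_wordsS mulr0 add0r (bigD1 a) //= eqxx [X in _ + X]big1 ?addr0 //.
by move=> x /negPf xa; rewrite big1 // => u _; rewrite eq_sym xa mulr0.
Qed.

Lemma shuffle_nil c d : shuffle c d [::] = c [::] * d [::].
Proof.
by rewrite (@shuffle_words _ _ _ 0 0) // !big_seq1 /= /word eqxx mulr1.
Qed.

(** Leibniz rule: the first letter of a shuffle comes from one factor or the other. With
    [shuffle_nil] it reduces the ring laws to inductions on the word. *)
Lemma shuffle_cons c d (a : 'I_m) w :
  shuffle c d (a :: w) = shuffle (lder a c) d w + shuffle c (lder a d) w.
Proof.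
pose n := size w.
rewrite (@shuffle_words _ _ _ n.+1 n.+1) //.
under eq_bigr do under eq_bigr do rewrite shuffle_word_cons mulrDr.
under eq_bigr do rewrite big_split.
rewrite big_split; congr (_ + _).
  rewrite (@shuffle_words _ _ _ n n.+1) // exchange_big [RHS]exchange_big /=.
  apply: eq_bigr => v _; under eq_bigr do rewrite mulrAC.
  rewrite -mulr_suml sum_words_head mulr_suml.
  by apply: eq_bigr => u _; rewrite mulrAC.
rewrite (@shuffle_words _ _ _ n.+1 n) //; apply: eq_bigr => u _.
under eq_bigr do rewrite -mulrA.
rewrite -mulr_sumr sum_words_head mulr_sumr.
by apply: eq_bigr => v _; rewrite mulrA.
Qed.

Lemma shuffleC : commutative (@shuffle R m).
Proof.
move=> c d; apply/funext=> w; elim: w c d => [|a w IH] c d.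
  by rewrite !shuffle_nil mulrC.
by rewrite !shuffle_cons IH [X in _ + X]IH addrC.
Qed.

Lemma shuffleDl c c' d w :
  shuffle (fun u => c u + c' u) d w = shuffle c d w + shuffle c' d w.
Proof.
elim: w c c' d => [|a w IH] c c' d; first by rewrite !shuffle_nil mulrDl.
by rewrite !shuffle_cons -/(lder a c) (IH (lder a c)) IH addrACA.
Qed.

Lemma shuffleDr c d d' w :
  shuffle c (fun u => d u + d' u) w = shuffle c d w + shuffle c d' w.
Proof. by rewrite !(shuffleC c) shuffleDl. Qed.

Lemma shuffleA : associative (@shuffle R m).
Proof.
move=> c d e; apply/funext=> w; elim: w c d e => [|a w IH] c d e.
  by rewrite !shuffle_nil mulrA.
have lderM x y : lder a (shuffle x y) =
    (fun u => shuffle (lder a x) y u + shuffle x (lder a y) u).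
  by apply/funext=> u; rewrite -shuffle_cons.
by rewrite !shuffle_cons !lderM shuffleDl shuffleDr !IH addrA.
Qed.

Lemma shuffle1l : left_id (fps1 R m) (@shuffle R m).
Proof.
move=> c; apply/funext=> w; elim: w c => [|a w IH] c.
  by rewrite shuffle_nil mul1r.
by rewrite shuffle_cons IH -/(fps0 R m) shuffle0l add0r.
Qed.
End LeftDerivative.

(** * The ring of series under the shuffle product, and agreement up to a given order *)

Section ShuffleAlgebra.
Variables (R : realType) (m : nat).

(* A copy of [fps R m], since function types already carry the pointwise ring
   structure. *)
Definition shalg : Type := fps R m.

HB.instance Definition _ := GRing.Zmodule.copy shalg (seq 'I_m -> R).

Lemma shalg_mulDl : left_distributive (@shuffle R m : shalg -> shalg -> shalg) +%R.
Proof. by move=> c c' d; apply/funext=> w; exact: shuffleDl. Qed.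

Lemma shalg_1neq0 : (fps1 R m : shalg) != 0.
Proof. by apply/eqP=> /(congr1 (@^~ [::]))/eqP; rewrite /= /fps1 /word eqxx oner_eq0. Qed.

HB.instance Definition _ := GRing.Zmodule_isComNzRing.Build shalg
  (@shuffleA R m) (@shuffleC R m) (@shuffle1l R m) shalg_mulDl shalg_1neq0.

Implicit Types (a : 'I_m) (f g : shalg) (d : fpst R m).

Lemma shalgDE f g w : (f + g) w = f w + g w.
Proof. by []. Qed.

Lemma shalg_sumE (I : Type) (r : seq I) (P : pred I) (F : I -> shalg) w :
  (\sum_(i <- r | P i) F i) w = \sum_(i <- r | P i) F i w.
Proof. by elim/big_rec2: _ => // i x y _ <-. Qed.

Lemma shalgM_nil f g : (f * g) [::] = f [::] * g [::].
Proof. exact: shuffle_nil. Qed.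

Definition der a f : shalg := lder a f.

Lemma derM a f g : der a (f * g) = der a f * g + f * der a g.
Proof. by apply/funext=> w; exact: shuffle_cons. Qed.

(** Congruence modulo series of order at least [n]. The ring operations respect it, and a derivative
    costs one order. *)
Definition agree (n : nat) f g := forall w, (size w < n)%N -> f w = g w.

Lemma agreeW n f g : agree n.+1 f g -> agree n f g.
Proof. by move=> fg w wn; apply: fg; rewrite ltnS ltnW. Qed.

Lemma agree_der n a f g : agree n.+1 f g -> agree n (der a f) (der a g).
Proof. by move=> fg w wn; exact: fg. Qed.

Lemma agreeD n f f' g g' :
  agree n f f' -> agree n g g' -> agree n (f + g) (f' + g').
Proof. by move=> ff' gg' w wn; congr (_ + _); [exact: ff' | exact: gg']. Qed.

Lemma agreeN n f f' : agree n f f' -> agree n (- f) (- f').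
Proof. by move=> ff' w wn; congr (- _); exact: ff'. Qed.

Lemma agreeMn n k f f' : agree n f f' -> agree n (f *+ k) (f' *+ k).
Proof. by move=> ff'; elim: k => // k IHk; rewrite !mulrS; exact: agreeD. Qed.

Lemma agree_sum n (I : Type) (r : seq I) (P : pred I) (F G : I -> shalg) :
  (forall i, P i -> agree n (F i) (G i)) ->
  agree n (\sum_(i <- r | P i) F i) (\sum_(i <- r | P i) G i).
Proof.
move=> FG; elim/big_rec2: _ => // i x y Pi xy.
by apply: agreeD => //; exact: FG.
Qed.

Lemma agreeM n f f' g g' :
  agree n f f' -> agree n g g' -> agree n (f * g) (f' * g').
Proof.
elim: n f f' g g' => // n IH f f' g g' ff' gg' [|a w] wn.
  by rewrite !shalgM_nil ff' ?gg'.
rewrite -[LHS]/(der a (f * g) w) -[RHS]/(der a (f' * g') w) !derM.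
apply: (agreeD _ _ (w := w) wn); apply: IH => //; first [exact: agree_der | exact: agreeW].
Qed.

Lemma agreeX n k f f' : agree n f f' -> agree n (f ^+ k) (f' ^+ k).
Proof. by move=> ff'; elim: k => // k IHk; rewrite !exprS; exact: agreeM. Qed.

Lemma agree_step n f g : f [::] = g [::] ->
  (forall a, agree n (der a f) (der a g)) -> agree n.+1 f g.
Proof. by move=> fg0 fgS [|a w] // wn; exact: fgS. Qed.

Lemma agree_eq f g : (forall n, agree n f g) -> f = g.
Proof. by move=> fg; apply/funext=> w; exact: (fg (size w).+1). Qed.

(** [P a] loses no order, while passing from the derivatives back to the series gains one; so two
    solutions agree to every order. *)
Lemma der_system_uniq (P : 'I_m -> shalg -> shalg) f g :
  (forall n a h h', agree n h h' -> agree n (P a h) (P a h')) ->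
  f [::] = g [::] ->
  (forall a, der a f = P a f) -> (forall a, der a g = P a g) -> f = g.
Proof.
move=> Pn fg0 fP gP; apply: agree_eq; elim=> // n IHn.
by apply: agree_step => // a; rewrite fP gP; exact: Pn.
Qed.

(** * Mixed composition product and group product *)

Definition diag d (k : nat) : shalg :=
  if k is k'.+1 then (if insub k' is Some i then d i else 0) else 1.

(** The convention [diag d 0 = 1] absorbs the isolated term [lcat i e], so one formula covers all
    leading letters. *)
Lemma der_phi_letter d i a (e : fps R m) w :
  phi_letter d i e (a :: w) =
  if (i <= a)%N then (diag d (a - i) * (e : shalg)) w else 0.
Proof.
rewrite /phi_letter /=; case: ltngtP => [ia|ai|->].
- rewrite add0r -(subnSK ia) /=; case: insubP => [j _ jE|].
    rewrite (bigD1 j) /=; last by rewrite jE subnSK // subnKC ?ltn_ord // ltnW.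
    rewrite jE subnSK // subnKC ?(ltnW ia) // eqxx big1 ?addr0 // => j' /andP[_].
    rewrite -val_eqE /= jE => j'j; case: eqP => // aE; case/negP: j'j.
    by rewrite aE addnS subSS addKn.
  case/negP; have m0 : (0 < m)%N := leq_ltn_trans (leq0n _) (ltn_ord a).
  by rewrite -ltnS prednK // subnSK // (leq_ltn_trans (leq_subr _ _)).
- rewrite add0r big1 // => j _; case: eqP => // aE.
  by move: ai; rewrite aE ltnNge leq_addr.
- rewrite subnn mul1r big1 ?addr0 // => j _; case: eqP => // aE.
  by move/eqP: aE; rewrite -{1}(addn0 a) eqn_add2l.
Qed.

Lemma mcomp_words (c : fps R m) d w n : (size w <= n)%N ->
  mcomp c d w = \sum_(u <- words m n) c u * phi d u (fps1 R m) w.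
Proof.
move=> wn; apply: fsum_seqT; first exact: words_uniq.
move=> u; rewrite mem_words -ltnNge => un.
by rewrite phi_low ?mulr0 // (leq_ltn_trans wn).
Qed.

Lemma mcomp_nil (c : fps R m) d : mcomp c d [::] = c [::].
Proof. by rewrite (@mcomp_words _ _ _ 0) // big_seq1 /= /fps1 /word eqxx mulr1. Qed.

Lemma mcompD (c c' : shalg) d :
  mcomp (c + c' : shalg) d = (mcomp c d : shalg) + (mcomp c' d : shalg).
Proof.
apply/funext=> w; rewrite shalgDE !(@mcomp_words _ _ _ (size w)) // -big_split.
by apply: eq_bigr => u _; rewrite shalgDE mulrDl.
Qed.

Lemma shuffle_sumr (I : Type) (s : seq I) (r : I -> R) (F : I -> fps R m) f w :
  shuffle f (fun v => \sum_(i <- s) r i * F i v) w =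
  \sum_(i <- s) r i * shuffle f (F i) w.
Proof.
elim: w f F => [|a w IH] f F.
  rewrite shuffle_nil mulr_sumr; apply: eq_bigr => i _.
  by rewrite shuffle_nil mulrCA.
rewrite shuffle_cons IH (IH f (fun i => lder a (F i))) -big_split.
by apply: eq_bigr => i _; rewrite shuffle_cons mulrDr.
Qed.

(** Chain rule: group the words of [c] by their first letter [i]. That letter contributes
    [diag d (a - i)], and the remaining letters rebuild the composition of [der i c]. *)
Lemma der_mcomp (c : shalg) d a :
  der a (mcomp c d) =
  \sum_(i < m | (i <= a)%N) diag d (a - i) * (mcomp (der i c) d : shalg).
Proof.
apply/funext=> w; rewrite shalg_sumE [LHS](@mcomp_words _ _ _ (size w).+1) //.
rewrite big_wordsS /= {1}/fps1 /word /= mulr0 add0r [RHS]big_mkcond.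
apply: eq_bigr => i _.
under eq_bigr do rewrite -/(phi d _ _) der_phi_letter.
case: leqP => ia; last by rewrite big1 // => u _; rewrite mulr0.
rewrite -(shuffle_sumr _ _ (fun u => phi d u (fps1 R m))).
(* The truncated sum matches the full composition on words no longer than [w], which are all that
   the product sees at [w]. *)
have : agree (size w).+1
   (fun v => \sum_(u <- words m (size w)) c (i :: u) * phi d u (fps1 R m) v)
   (mcomp (der i c) d).
  by move=> v vw; rewrite (@mcomp_words _ _ _ (size w)).
by move/(@agreeM _ (diag d (a - i)) (diag d (a - i)) _ _ (fun _ _ => erefl)); apply.
Qed.

(** Both sides obey the same Leibniz recursion. The induction on the order is uniform in [c] and
    [c'], which derivatives replace. *)
Lemma mcompM (c c' : shalg) d :
  mcomp (c * c' : shalg) d = (mcomp c d : shalg) * (mcomp c' d : shalg).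
Proof.
apply: agree_eq => n; elim: n c c' => // n IH c c'; apply: agree_step.
  by rewrite shalgM_nil !mcomp_nil shalgM_nil.
move=> a; rewrite derM !der_mcomp mulr_suml mulr_sumr -big_split /=.
apply: agree_sum => i _; rewrite derM mcompD mulrDr -mulrA [X in agree _ _ (_ + X)]mulrCA.
by apply: agreeD; apply: agreeM => //; exact: IH.
Qed.

Lemma mcomp0r d : mcomp (0 : shalg) d = 0 :> shalg.
Proof. exact: mcomp0. Qed.

Lemma mcomp1r d : mcomp (1 : shalg) d = 1 :> shalg.
Proof. exact: mcomp1. Qed.

Lemma mcompX (c : shalg) d k :
  mcomp (c ^+ k : shalg) d = (mcomp c d : shalg) ^+ k.
Proof.
elim: k => [|k IHk]; first by rewrite !expr0 mcomp1r.
by rewrite !exprS mcompM IHk.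
Qed.

Lemma mcompN (c : shalg) d : mcomp (- c) d = - (mcomp c d : shalg).
Proof. by apply/eqP; rewrite -addr_eq0 -mcompD addNr mcomp0r. Qed.

Lemma toep_diag d (a b : 'I_m) :
  toep d a b = if (a <= b)%N then diag d (b - a) else 0.
Proof. by rewrite toepE. Qed.

(** The first row of a product of Toeplitz matrices is a convolution of their diagonals. *)
Lemma gmulE (c d : fpst R m) (i : 'I_m.-1) :
  gmul c d i =
  \sum_(k < i.+2) (mcomp (diag c k) d : shalg) * diag d (i.+1 - k).
Proof.
apply/funext=> w; rewrite /gmul mxE shalg_sumE.
have im : (i.+2 <= m)%N := colS_subproof i.
rewrite -(big_mkord xpredT (fun k => ((mcomp (diag c k) d : shalg) * diag d (i.+1 - k)) w)).
rewrite (big_nat_widen _ _ _ _ _ im) big_mkord [RHS]big_mkcond.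
apply: eq_bigr => k _.
rewrite mxE !toep_diag /= subn0 ltnS; case: leqP => // _.
by rewrite -/(fps0 R m) shuffle0r.
Qed.

(** * The Abel and Ferfera series as solutions of differential systems *)

(* For z = z(t), z(0) = 1, with generating series [rising P 1], the solution of
   z' = \sum_(i | P i) v_i z^(i+2), this is the generating series of z^k. *)
Fixpoint rising (P : pred 'I_m) (k : nat) (w : seq 'I_m) : R :=
  if w is i :: w' then (if P i then k%:R * rising P (k + i.+1) w' else 0) else 1.

Lemma der_rising (P : pred 'I_m) k a :
  der a (rising P k) =
  if P a then (rising P (k + a.+1) : shalg) *+ k else 0.
Proof.
apply/funext=> w; rewrite /der /lder /=; case: (P a) => //.
suff natE j : ((rising P (k + a.+1) : shalg) *+ j) w =
  j%:R * rising P (k + a.+1) w by rewrite natE.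
elim: j => [|j IHj]; first by rewrite mulr0n mul0r.
by rewrite mulrSr -natr1 mulrDl mul1r -IHj.
Qed.

(** For [P a], the derivative of [z^k z^l] is [k z^(k+a+1) z^l + l z^k z^(l+a+1)], which the
    induction on the order collapses to [(k+l) z^(k+l+a+1)]. *)
Lemma risingD (P : pred 'I_m) k l :
  (rising P (k + l) : shalg) = (rising P k : shalg) * (rising P l : shalg).
Proof.
apply: agree_eq => n; elim: n k l => // n IH k l; apply: agree_step.
  by rewrite shalgM_nil /= mulr1.
move=> a; rewrite derM !der_rising; case: (P a); last by rewrite mul0r mulr0 addr0.
rewrite mulrnAl mulrnAr mulrnDr; apply: agreeD; apply: agreeMn.
  by rewrite addnAC; exact: IH.
by rewrite -addnA; exact: IH.
Qed.

Lemma risingX (P : pred 'I_m) k : (rising P k : shalg) = (rising P 1 : shalg) ^+ k.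
Proof.
elim: k => [|k IHk]; last by rewrite -add1n risingD IHk exprS.
(* At index 0 the leading factor kills every nonempty word. *)
rewrite expr0; apply/funext=> -[|i w].
  by rewrite [RHS]/(fps1 R m [::]) /fps1 /word eqxx.
by rewrite [RHS]/(fps1 R m _) /fps1 /word /= mul0r; case: (P i).
Qed.

Lemma der_rising1 (P : pred 'I_m) a :
  der a (rising P 1) = if P a then (rising P 1 : shalg) ^+ a.+2 else 0.
Proof. by rewrite der_rising add1n risingX. Qed.

Lemma rcat_rcons (c : fps R m) a u b :
  rcat c a (rcons u b) = if b == a then c u else 0.
Proof.
by case: u => [|x u] //=; rewrite last_rcons belast_rcons.
Qed.

Lemma rising_rcons k u a :
  rising predT k (rcons u a) =
  rising predT k u * (k + sumn [seq (i : 'I_m).+1 | i <- u])%:R.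
Proof.
elim: u k => [|x u IH] k /=; first by rewrite addn0 mulr1 mul1r.
by rewrite IH mulrA addnA.
Qed.

Lemma abel_rising : abel R m = rising predT 1.
Proof.
apply/funext=> w; pose deg w := sumn [seq (i : 'I_m).+1 | i <- w].
(* By homogeneity, only one component contributes at [w]. *)
transitivity (abel_hom R m (deg w).+1 w).
  rewrite /abel -(fsbig_widen [set (deg w).+1]).
  - by rewrite fsbig_set1.
  - by move=> n ->.
  - move=> n [_ /= nw]; rewrite /preimage /= abel_hom_deg //; exact/eqP.
elim/last_ind: w => [|u a IH]; first by rewrite /= /fps1 /word eqxx.
rewrite rising_rcons -IH.
have -> : deg (rcons u a) = (deg u + a).+1.
  by rewrite /deg map_rcons sumn_rcons addnS.
rewrite [LHS]/= (bigD1 a) //= rcat_rcons eqxx big1 ?addr0.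
  by rewrite ?subSS -addSn addnK mulrC add1n.
by move=> i /negPf ia; rewrite rcat_rcons eq_sym ia mulr0.
Qed.

Lemma ferfera_rising : ferfera R m = rising (fun i => i == 0%N :> nat) 1.
Proof.
(* Starting at [k.+1] makes the induction go through: [(k+1)...(k+n) k! = (k+n)!]. *)
suff H k w : rising (fun i => i == 0%N :> nat) k.+1 w * k`!%:R =
  if all (fun x : 'I_m => x == 0%N :> nat) w then (size w + k)`!%:R else 0.
  by apply/funext=> w; rewrite /ferfera -[RHS]mulr1 (H 0) addn0.
elim: w k => [|i w IH] k /=; first by rewrite mul1r.
case: eqP => [->|_] /=; last by rewrite mul0r.
by rewrite addn1 addSnnS -IH factS natrM mulrCA !mulrA.
Qed.

End ShuffleAlgebra.

Arguments diag {R m} d k : simpl never.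

(** * Inverting [I - c_F N] and composing with the Ferfera series *)

Section FerferaComposition.
Variables (R : realType) (m : nat) (hm : (2 <= m)%N).
Local Notation S := (shalg R m).
Let A : S := abel R m.
Let F : S := ferfera R m.

Lemma abel_nil : A [::] = 1.
Proof. by rewrite /A abel_rising. Qed.

Lemma ferfera_nil : F [::] = 1.
Proof. by rewrite /F ferfera_rising. Qed.

Lemma der_abel a : der a A = A ^+ a.+2.
Proof. by rewrite /A abel_rising der_rising1. Qed.

Lemma der_ferfera a : der a F = if a == 0%N :> nat then F ^+ 2 else 0.
Proof. by rewrite /F ferfera_rising der_rising1; case: eqP => // ->. Qed.

Lemma der_mcomp_ferfera d a :
  der a (mcomp F d) = diag d a * (mcomp F d : S) ^+ 2.
Proof.
have m0 : (0 < m)%N := leq_ltn_trans (leq0n a) (ltn_ord a).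
rewrite der_mcomp (bigD1 (Ordinal m0)) //= subn0 der_ferfera /= mcompX.
rewrite big1 ?addr0 // => i /andP[_ i0]; rewrite der_ferfera.
by rewrite -val_eqE /= in i0; rewrite (negPf i0) mcomp0r mulr0.
Qed.

(** The hypothesis closes the system for [z = mcomp F d]: it becomes [D_a z = z^a z^2], the Abel
    system with letters numbered from 0. *)
Lemma mcomp_ferfera d :
  (forall a : 'I_m, diag d a = (mcomp F d : S) ^+ a) -> mcomp F d = A.
Proof.
move=> dE; apply: (@der_system_uniq _ _ (fun a h => h ^+ a.+2)).
- by move=> n a h h'; exact: agreeX.
- by rewrite mcomp_nil ferfera_nil abel_nil.
- by move=> a; rewrite der_mcomp_ferfera dE -exprD addn2.
- exact: der_abel.
Qed.

Lemma diag_subN k : (k < m)%N ->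
  diag (subN F) k = if k is k'.+1 then (if k' is 0 then - F else 0) else 1.
Proof.
case: k => // k km; rewrite /diag; case: insubP => [i _ <-|]; last by rewrite ltn_predRL km.
by rewrite /subN /=; case: (nat_of_ord i).
Qed.

(** Only two diagonals of [I - c_F N] are nonzero, so the convolution keeps two terms. *)
Lemma gmul_subN_l e (i : 'I_m.-1) :
  gmul (subN F) e i = diag e i.+1 - (mcomp F e : S) * diag e i.
Proof.
have im : (i.+1 < m)%N := colS_subproof i.
rewrite gmulE !big_ord_recl big1 ?addr0 => [|k _]; last first.
  rewrite diag_subN ?mcomp0r ?mul0r //.
  by apply: leq_ltn_trans im; exact: (ltn_ord k).
rewrite !diag_subN ?(leq_trans _ hm) //= mcomp1r mul1r subn0 subn1.
by rewrite mcompN mulNr.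
Qed.

Lemma gmul_subN_r e (i : 'I_m.-1) :
  gmul e (subN F) i =
  (mcomp (diag e i.+1) (subN F) : S) - (mcomp (diag e i) (subN F) : S) * F.
Proof.
have im : (i.+1 < m)%N := colS_subproof i.
rewrite gmulE !big_ord_recr /= subnn mulr1 subSnn addrC.
rewrite diag_subN ?(leq_trans _ hm) // mulrN big1 ?add0r // => k _.
rewrite diag_subN; last by rewrite (leq_ltn_trans _ im) // leq_subr.
by rewrite subSn ?(ltnW (ltn_ord k)) // -(subnSK (ltn_ord k)) mulr0.
Qed.

(** The chain rule keeps the terms [i = a] and, if [a > 0], [i = a - 1], giving
    [h^(a+2) - h^(a+1) F]. At [h = F] this vanishes for [a > 0] and leaves [F^2] for [a = 0], as for
    the Ferfera series. *)
Lemma mcomp_abel : mcomp A (subN F) = F.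
Proof.
apply: (@der_system_uniq _ _
  (fun a h => h ^+ a.+2 - (if a == 0%N :> nat then 0 else h ^+ a.+1 * F))).
- move=> n a h h' hh'; apply: agreeD; first exact: agreeX.
  apply: agreeN; case: ifP => // _.
  by apply: agreeM => //; exact: agreeX.
- by rewrite mcomp_nil ferfera_nil abel_nil.
- move=> a; rewrite der_mcomp.
  under eq_bigr do rewrite der_abel mcompX.
  rewrite (bigD1 a) //= subnn mul1r; congr (_ + _).
  case: eqP => [a0|/eqP a0].
    rewrite big1 ?oppr0 // => i; rewrite a0 leqn0 -val_eqE /= a0.
    by case: (nat_of_ord i).
  have am : (a.-1 < m)%N by rewrite (leq_ltn_trans (leq_pred a)).
  rewrite -lt0n in a0.
  rewrite (bigD1 (Ordinal am)) /=; last by rewrite leq_pred -val_eqE /= ltn_eqF // prednK.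
  rewrite (_ : (a - a.-1)%N = 1%N); last by rewrite -{1}(prednK a0) subSnn.
  rewrite diag_subN // prednK // mulNr mulrC big1 ?addr0 // => i.
  rewrite -!val_eqE /= => /andP[/andP[ia nia] nia'].
  have ia2 : (i.+1 < a)%N.
    by move: ia nia nia' a0; case: (nat_of_ord a) => [|k] //= *; lia.
  rewrite diag_subN; last by rewrite (leq_ltn_trans (leq_subr _ _)).
  by rewrite -(subnSK (ltnW ia2)) -(subnSK ia2) mul0r.
- move=> a; rewrite der_ferfera; case: eqP => [->|_]; first by rewrite subr0.
  by rewrite -exprSr subrr.
Qed.

Lemma subN_invertible :
  exists e, gmul (subN F) e = gone R m /\ gmul e (subN F) = gone R m.
Proof.
pose e : fpst R m := fun i => A ^+ i.+1; exists e.
have diagE k : (k < m)%N -> diag e k = A ^+ k.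
  case: k => [|k] km; first by rewrite expr0.
  by rewrite /diag; case: insubP => [i _ <-|] //; rewrite ltn_predRL km.
(* [mcomp_ferfera] would be circular here, since its hypothesis involves [mcomp F e]; the powers of
   [A] are kept as fixed coefficients instead. *)
have FE : mcomp F e = A.
  apply: (@der_system_uniq _ _ (fun a h => A ^+ a * h ^+ 2)).
  - by move=> n a h h' hh'; apply: agreeM => //; exact: agreeX.
  - by rewrite mcomp_nil ferfera_nil abel_nil.
  - by move=> a; rewrite der_mcomp_ferfera diagE.
  - by move=> a; rewrite der_abel -exprD addn2.
split; apply/funext=> i; have im : (i.+1 < m)%N := colS_subproof i.
  by rewrite gmul_subN_l FE !diagE ?(ltnW im) // -exprS subrr.
(* Composition with [subN F] turns each power of [A] into the same power of [F]. *)
rewrite gmul_subN_r !diagE ?(ltnW im) // !mcompX mcomp_abel.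
by rewrite -exprSr subrr.
Qed.

(** Read diagonal by diagonal, the equation says [e_(k+1) = z e_k] with [z = mcomp F e]; from
    [e_0 = 1] follows [e_k = z^k]. *)
Lemma right_inverse_subN e :
  gmul (subN F) e = gone R m -> mcomp F e = A.
Proof.
move=> eR; apply: mcomp_ferfera => a; case: a => k km /=.
elim: k km => [|k IHk] km; first by rewrite expr0.
have km1 : (k < m.-1)%N by rewrite ltn_predRL.
have := congr1 (fun g : fpst R m => g (Ordinal km1)) eR.
rewrite /= gmul_subN_l /= => /eqP; rewrite [gone R m _]/(0 : S) subr_eq0 => /eqP ->.
by rewrite IHk ?(ltnW km) // exprS.
Qed.
End FerferaComposition.

Unset Implicit Arguments.
Local Close Scope ring_scope.

Theorem theorem3 (R : realType) (m : nat) (hm : 2 <= m) :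
  abel R m = mcomp (ferfera R m) (ginv (subN (ferfera R m))).
Proof.
apply/esym/(right_inverse_subN hm).
(* Invertibility ensures that [ginv] satisfies its defining equations rather than returning the
   default value. *)
by have [] := xgetPex (subN (ferfera R m)) (subN_invertible R hm).
Qed.
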